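(* The variety $\mathrm{LeibN}^3$ of nilpotent Leibniz algebra laws on $\mathbb{C}^3$ is the union of the two irreducible components $\overline{\mathcal{O}(\mu_1)}^Z$ and $\overline{\bigcup_{b\in\mathbb{C}}\mathcal{O}(\mu_{2,b})}^Z$, where, in a basis $\{e_1,e_2,e_3\}$ of $\mathbb{C}^3$ and with all unwritten products of basis vectors equal to zero, $\mu_1$ is given by $\mu_1(e_1,e_1)=e_2$, $\mu_1(e_2,e_1)=e_3$, and for $b\in\mathbb{C}$ the law $\mu_{2,b}$ is given by $\mu_{2,b}(e_1,e_1)=e_2$, $\mu_{2,b}(e_3,e_3)=b\,e_2$, $\mu_{2,b}(e_1,e_3)=e_2$.
   Context: A Leibniz algebra law on $\mathbb{C}^n$ is a bilinear map $\mu:\mathbb{C}^n\times\mathbb{C}^n\to\mathbb{C}^n$ satisfying $\mu(x,\mu(y,z))=\mu(\mu(x,y),z)-\mu(\mu(x,z),y)$ for all $x,y,z$. Put $\mathcal{C}^1=\mathbb{C}^n$ and $\mathcal{C}^{k+1}=\mu(\mathcal{C}^k,\mathbb{C}^n)$ (the span of the products); $\mu$ is nilpotent if $\mathcal{C}^k=\{0\}$ for some $k$. $\mathrm{LeibN}^n$ denotes the set of nilpotent Leibniz algebra laws on $\mathbb{C}^n$; identifying a law with its structure constants $(a_{ij}^k)$, $\mu(e_i,e_j)=\sum_k a_{ij}^k e_k$, in a fixed basis, it is an algebraic subset of $\mathbb{C}^{n^3}$. $GL(n,\mathbb{C})$ acts on it by $(f,\mu)\mapsto f^{-1}\circ\mu\circ(f\times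 f)$, and $\mathcal{O}(\mu)$ denotes the orbit of $\mu$. $\overline{S}^Z$ denotes the closure of $S$ in the Zariski topology, and irreducible components are taken in the Zariski topology. *)

(* Defs.v *)
From HB Require Import structures.
From mathcomp Require Import all_boot all_order all_algebra.
From mathcomp Require Import boolp classical_sets reals topology_structure.
From mathcomp Require Import complex.
From mathcomp Require Import mpoly.
Set Implicit Arguments. Unset Strict Implicit. Unset Printing Implicit Defensive.
Import GRing.Theory.
Local Open Scope classical_set_scope.
Local Open Scope ring_scope.

(* The affine space F^I with its Zariski topology; the alias keeps this
   topology apart from any other one carried by finite functions. *)
Definition affine (F : fieldType) (I : finType) : Type := {ffun I -> F}.

HB.instance Definition _ (F : fieldType) (I : finType) :=
  Choice.copy (affine F I) {ffun I -> F}.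

Section Zariski.
Variables (F : fieldType) (I : finType).
Implicit Types (p : {mpoly F[#|I|]}) (a : affine F I).

(* Variable number k of p stands for the coordinate [enum_val k : I]. *)
Definition poly_eval p a : F := p.@[fun k => a (enum_val k)].

Definition zero_locus (S : set {mpoly F[#|I|]}) : set (affine F I) :=
  [set a | forall p, S p -> poly_eval p a = 0].

Definition zariski_open (U : set (affine F I)) : Prop :=
  exists S, U = ~` zero_locus S.

Lemma zariski_openT : zariski_open setT.
Proof.
exists [set (1 : {mpoly F[#|I|]})]; rewrite -[LHS]setCK setCT; congr (~` _).
apply/seteqP; split=> // a /(_ 1 erefl) /eqP.
by rewrite /poly_eval meval1 oner_eq0.
Qed.

Lemma zariski_openI : setI_closed zariski_open.
Proof.
move=> _ _ [S ->] [T ->].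
exists [set r | exists p q, [/\ S p, T q & r = p * q]].
rewrite -setCU; congr (~` _); apply/seteqP; split=> a.
  move=> [Sa|Ta] r [p [q [Sp Tq ->]]]; rewrite /poly_eval mevalM.
    by have := Sa _ Sp; rewrite /poly_eval => ->; rewrite mul0r.
  by have := Ta _ Tq; rewrite /poly_eval => ->; rewrite mulr0.
move=> STa; apply: contrapT => /not_orP[/existsNP[p /not_implyP[Sp /eqP pa]]].
move=> /existsNP[q /not_implyP[Tq /eqP qa]].
have /eqP := STa (p * q) (ex_intro _ p (ex_intro _ q (And3 Sp Tq erefl))).
by rewrite /poly_eval mevalM mulf_eq0 (negPf pa) (negPf qa).
Qed.

Lemma zariski_open_bigU (J : Type) (f : J -> set (affine F I)) :
  (forall j, zariski_open (f j)) -> zariski_open (\bigcup_j f j).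
Proof.
move=> fop; exists [set p | exists2 S, S p & exists j, f j = ~` zero_locus S].
apply/seteqP; split=> a.
  move=> [j _ fja] Sa; have [S fjS] := fop j; move: fja; rewrite fjS; apply.
  by move=> p Sp; apply: Sa; exists S => //; exists j.
move=> nSa; apply: contrapT => nfa; apply: nSa => p [S Sp [j fjS]].
have : ~ f j a by move=> fja; apply: nfa; exists j.
by rewrite fjS => /contrapT; apply.
Qed.

HB.instance Definition _ := isOpenTopological.Build (affine F I)
  zariski_openT zariski_openI zariski_open_bigU.

Lemma zariski_closedP (Z : set (affine F I)) :
  closed Z <-> exists S, Z = zero_locus S.
Proof.
rewrite -openC; split=> [[S /(congr1 (@setC _))]|[S ->]].
  by rewrite !setCK => ->; exists S.
by exists S.
Qed.

End Zariski.

Section Irreducible.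
Variable T : topologicalType.

Definition irreducible (Z : set T) : Prop :=
  Z !=set0 /\ forall A B : set T, closed A -> closed B ->
    Z `<=` A `|` B -> Z `<=` A \/ Z `<=` B.

Definition irreducible_component (X Z : set T) : Prop :=
  [/\ Z `<=` X, irreducible Z &
      forall Y, Y `<=` X -> irreducible Y -> Z `<=` Y -> Y = Z].

End Irreducible.

Definition linear_span (F : fieldType) (V : vectType F) (S : set V) : set V :=
  [set v | forall U : {vspace V}, (forall s, S s -> s \in U) -> v \in U].

Section Laws.
Variables (F : fieldType) (n : nat).
Local Notation V := 'rV[F]_n.
Implicit Types (mu : V -> V -> V).

Definition leibniz mu : Prop :=
  forall x y z, mu x (mu y z) = mu (mu x y) z - mu (mu x z) y.

(* [lower_central mu k] is C^(k+1): the mathematical indexing starts at 1. *)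
Fixpoint lower_central mu (k : nat) : set V :=
  if k is k'.+1 then
    linear_span [set mu x y | x in lower_central mu k' & y in setT]
  else setT.

Definition nilpotent_law mu : Prop := exists k, lower_central mu k = [set 0].

(* The coordinate (i, j, k) is the structure constant a_ij^k. *)
Definition law_space := affine F ('I_n * 'I_n * 'I_n)%type.

Definition law_of (a : law_space) (x y : V) : V :=
  \row_k \sum_i \sum_j a (i, j, k) * x 0 i * y 0 j.

Definition constants_of mu : law_space :=
  [ffun t => mu (delta_mx 0 t.1.1) (delta_mx 0 t.1.2) 0 t.2].

Lemma law_ofK : cancel law_of constants_of.
Proof.
move=> a; apply/ffunP=> -[[i j] k]; rewrite ffunE mxE /=.
rewrite (bigD1 i) //= (bigD1 j) //= !mxE !eqxx !mulr1 big1 => [|j' /negPf jj'].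
  rewrite big1 ?addr0 // => i' /negPf ii'; rewrite big1 // => j' _.
  by rewrite !mxE ii' andbF mulr0 mul0r.
by rewrite !mxE jj' andbF mulr0.
Qed.

Lemma constants_ofK (mu : {bilinear V -> V -> V}) :
  law_of (constants_of mu) =2 mu.
Proof.
move=> x y; have xE := row_sum_delta x; have yE := row_sum_delta y.
have -> : mu x y =
    \sum_i \sum_j (x 0 i * y 0 j) *: mu (delta_mx 0 i) (delta_mx 0 j).
  rewrite {1}xE linear_sumlz; apply: eq_bigr => i _.
  rewrite {1}yE linear_sumr; apply: eq_bigr => j _.
  by rewrite linearZl_LR linearZr_LR scalerA.
apply/rowP=> k; rewrite mxE summxE; apply: eq_bigr => i _.
rewrite summxE; apply: eq_bigr => j _.
by rewrite mxE ffunE /= -mulrA mulrC.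
Qed.

Definition LeibN : set law_space :=
  [set a | leibniz (law_of a) /\ nilpotent_law (law_of a)].

(* An element f of GL(n) is given by g in unitmx, with f x = x *m g. *)
Definition law_orbit (a : law_space) : set law_space :=
  [set b | exists2 g : 'M[F]_n, g \in unitmx &
    forall x y, law_of b x y = law_of a (x *m g) (y *m g) *m invmx g].

(* [basis_vec m] is e_m, numbered from 1; [T i j] is the product e_i e_j. *)
Definition basis_vec (m : nat) : V := \row_j (j.+1 == m)%:R.

Definition law_of_table (T : nat -> nat -> V) : law_space :=
  [ffun t : 'I_n * 'I_n * 'I_n => T t.1.1.+1 t.1.2.+1 0 t.2].

End Laws.

Arguments LeibN : clear implicits.

Section Dimension3.
Variable F : fieldType.
Local Notation e := (@basis_vec F 3).

Definition mu1 : law_space F 3 := law_of_table (fun i j =>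
  match i, j with
  | 1%N, 1%N => e 2
  | 2%N, 1%N => e 3
  | _, _ => 0
  end).

Definition mu2 (b : F) : law_space F 3 := law_of_table (fun i j =>
  match i, j with
  | 1%N, 1%N => e 2
  | 3%N, 3%N => b *: e 2
  | 1%N, 3%N => e 2
  | _, _ => 0
  end).

End Dimension3.

(* Main.v *)
Require Import Defs.
From HB Require Import structures.
From mathcomp Require Import all_boot all_order all_algebra.
From mathcomp Require Import boolp classical_sets reals topology_structure.
From mathcomp Require Import complex mpoly ring.
Set Implicit Arguments. Unset Strict Implicit. Unset Printing Implicit Defensive.
Import GRing.Theory.
Local Open Scope classical_set_scope.
Local Open Scope ring_scope.

(** A nilpotent Leibniz law on a space of dimension 3 satisfies ((xy)z)w = 0,
    because its lower central series drops in dimension until it vanishes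
    ([nilpotent_law_dim]).  There are two cases.

    If some (xy)z is nonzero, the Leibniz identity shows that (xx)x is nonzero
    already; then x, xx, (xx)x is a basis in which the law has the table of mu_1
    ([filiform_orbit]).

    If all (xy)z vanish, so do all x(yz), and the products span at most a line:
    two independent products would lie in the annihilator, leaving room for only
    one direction u outside it, so that every product would be a multiple of uu
    ([annihilated_line]).  Such a law is a bilinear form on a plane, with values
    in an annihilating line.  A form that is not symmetric and takes a nonzero
    value on some pair (f, f) can be brought to the shape of some mu_{2,b}
    ([mu2_orbit]).  With f a fixed basis vector, these conditions hold at all but
    finitely many points of the line joining an arbitrary form to that of
    mu_{2,0}, which puts every law of this second kind into the closure of the
    family ([annihilated_closure_mu2]).

    So LeibN^3 is the union of the two closures.  Each one is irreducible, since
    it is the closure of the values of a polynomial map on an open part of an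
    affine space ([irreducible_orbit_family]).  The identity (xy)z = 0 holds on
    the second set but not for mu_1; a law in the orbit of mu_1 has the form
    xy = phi(y) psi(x) with phi a linear form, and the resulting quadratic
    identities pass to the closure but fail for mu_{2,1}.  Hence neither set
    contains the other, and they are the irreducible components
    ([irreducible_component_setU]).

    All arguments about genericity are carried out on curves with polynomial
    coordinates: a polynomial in several variables restricted to such a curve is
    a polynomial in one variable, which has finitely many roots or vanishes
    identically.  The ground field may be any algebraically closed field. *)

(** * Irreducible components of a union *)

Section IrreducibleSets.
Variable T : topologicalType.
Implicit Types X Y Z : set T.

Lemma irreducible_closure Z : irreducible Z -> irreducible (closure Z).
Proof.
move=> [[z Zz] Zirr]; split; first by exists z; exact: subset_closure.
move=> A B Acl Bcl; have le_cl C : closed C -> Z `<=` C -> closure Z `<=` C.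
  by move=> Ccl /closureS; rewrite -((closure_id C).1 Ccl).
move=> /(subset_trans (@subset_closure _ Z)) /(Zirr _ _ Acl Bcl)[] ZC.
  by left; exact: le_cl.
by right; exact: le_cl.
Qed.

Lemma irreducible_component_setU X Y : closed X -> closed Y ->
  irreducible X -> irreducible Y -> ~ X `<=` Y -> ~ Y `<=` X ->
  forall Z, irreducible_component (X `|` Y) Z <-> Z = X \/ Z = Y.
Proof.
move=> Xcl Ycl Xirr Yirr nXY nYX.
have comp A B : closed A -> closed B -> irreducible A -> ~ A `<=` B ->
    irreducible_component (A `|` B) A.
  move=> Acl Bcl Airr nAB; split=> // C CAB [C0 Cirr] AC.
  have [CA|CB] := Cirr A B Acl Bcl CAB; first by apply/seteqP.
  by case: nAB; exact: subset_trans CB.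
move=> Z; split=> [[ZXY [Z0 Zirr] Zmax]|[]->].
- have [ZX|ZY] := Zirr X Y Xcl Ycl ZXY.
    by left; rewrite (Zmax X).
  by right; rewrite (Zmax Y).
- exact: comp.
- by rewrite setUC; exact: comp.
Qed.

End IrreducibleSets.

(** * Algebras of functions and the Zariski topology *)

(** Both the regular functions on an affine space and the polynomial functions
    of one variable are treated as instances, so that the polynomial nature of
    products, determinants, adjugates and laws is established once for the two
    uses: showing that sets of laws are closed, and building curves of laws. *)
Record function_algebra (F : fieldType) (T : Type) (P : set (T -> F)) : Prop :=
  FunctionAlgebra {
    algebra_cst : forall c, P (fun=> c);
    algebraD : forall f g, P f -> P g -> P (fun t => f t + g t);
    algebraM : forall f g, P f -> P g -> P (fun t => f t * g t)
  }.

Definition entrywise (F : fieldType) (T : Type) (P : set (T -> F)) m n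
  (A : T -> 'M[F]_(m, n)) : Prop := forall i j, P (fun t => A t i j).

Section FunctionAlgebra.
Variables (F : fieldType) (T : Type) (P : set (T -> F)).
Hypothesis algP : function_algebra P.

Lemma algebraB f g : P f -> P g -> P (fun t => f t - g t).
Proof.
move=> Pf Pg; rewrite (_ : (fun _ => _) = fun t => f t + -1 * g t); last first.
  by apply/funext => t; rewrite mulN1r.
by apply: algebraD => //; apply: algebraM => //; exact: algebra_cst.
Qed.

Lemma algebra_sum (I : Type) (r : seq I) (Q : pred I) (f : I -> T -> F) :
  (forall i, P (f i)) -> P (fun t => \sum_(i <- r | Q i) f i t).
Proof.
move=> Pf; elim: r => [|i r IHr].
  under eq_fun do rewrite big_nil.
  exact: algebra_cst.
under eq_fun do rewrite big_cons.
by case: (Q i) => //; exact: algebraD.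
Qed.

Lemma algebra_prod (I : Type) (r : seq I) (Q : pred I) (f : I -> T -> F) :
  (forall i, P (f i)) -> P (fun t => \prod_(i <- r | Q i) f i t).
Proof.
move=> Pf; elim: r => [|i r IHr].
  under eq_fun do rewrite big_nil.
  exact: algebra_cst.
under eq_fun do rewrite big_cons.
by case: (Q i) => //; exact: algebraM.
Qed.

Lemma entrywise_cst m n (A : 'M[F]_(m, n)) : entrywise P (fun=> A).
Proof. by move=> i j; exact: algebra_cst. Qed.

Lemma entrywiseB m n (A B : T -> 'M[F]_(m, n)) :
  entrywise P A -> entrywise P B -> entrywise P (fun t => A t - B t).
Proof.
by move=> PA PB i j; under eq_fun do rewrite !mxE; exact: algebraB.
Qed.

Lemma entrywiseZ m n f (A : T -> 'M[F]_(m, n)) :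
  P f -> entrywise P A -> entrywise P (fun t => f t *: A t).
Proof.
by move=> Pf PA i j; under eq_fun do rewrite !mxE; exact: algebraM.
Qed.

Lemma entrywise_mul m n p (A : T -> 'M[F]_(m, n)) (B : T -> 'M[F]_(n, p)) :
  entrywise P A -> entrywise P B -> entrywise P (fun t => A t *m B t).
Proof.
move=> PA PB i j; under eq_fun do rewrite !mxE.
by apply: algebra_sum => k; exact: algebraM.
Qed.

Lemma algebra_det n (A : T -> 'M[F]_n) :
  entrywise P A -> P (fun t => \det (A t)).
Proof.
move=> PA; apply: algebra_sum => s; apply: algebraM => //.
  exact: algebra_cst.
exact: algebra_prod.
Qed.

Lemma entrywise_adj n (A : T -> 'M[F]_n) :
  entrywise P A -> entrywise P (fun t => \adj (A t)).
Proof.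
move=> PA i j; under eq_fun do rewrite mxE.
apply: algebraM => //; first exact: algebra_cst.
by apply: algebra_det => k l; under eq_fun do rewrite !mxE; exact: PA.
Qed.

Lemma entrywise_law n (a : T -> law_space F n) (x y : T -> 'rV[F]_n) :
  (forall i, P (fun t => a t i)) -> entrywise P x -> entrywise P y ->
  entrywise P (fun t => law_of (a t) (x t) (y t)).
Proof.
move=> Pa Px Py i k; under eq_fun do rewrite mxE.
apply: algebra_sum => j; apply: algebra_sum => l.
by do 2![apply: algebraM => //].
Qed.

End FunctionAlgebra.

Section RegularFunctions.
Variables (F : fieldType) (I : finType).

Definition regular (f : affine F I -> F) : Prop :=
  exists p, forall a, poly_eval p a = f a.

Lemma regular_algebra : function_algebra regular.
Proof.
split=> [c|f g [p pf] [q qg]|f g [p pf] [q qg]].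
- by exists c%:MP => a; rewrite /poly_eval mevalC.
- by exists (p + q) => a; rewrite /poly_eval mevalD -pf -qg.
- by exists (p * q) => a; rewrite /poly_eval mevalM -pf -qg.
Qed.

Lemma regular_coord i : regular (fun a => a i).
Proof.
exists 'X_(enum_rank i) => a.
by rewrite /poly_eval mevalXU enum_rankK.
Qed.

Lemma closed_regular_eq f g : regular f -> regular g ->
  closed [set a | f a = g a].
Proof.
move=> Rf Rg; have [p pE] := algebraB regular_algebra Rf Rg.
apply/zariski_closedP; exists [set p]; apply/seteqP; split=> a /=.
  by move=> fg q ->; rewrite pE fg subrr.
by move=> /(_ p erefl); rewrite pE => /subr0_eq.
Qed.

Lemma closed_forall (J : Type) (Q : J -> set (affine F I)) :
  (forall j, closed (Q j)) -> closed [set a | forall j, Q j a].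
Proof.
move=> Qcl; rewrite (_ : [set a | _] = \bigcap_j Q j).
  by apply: closed_bigI => j _.
by apply/seteqP; split=> [a Qa j _|a Qa j]; [exact: Qa|exact: Qa].
Qed.

Lemma closed_entrywise_eq m n (A B : affine F I -> 'M[F]_(m, n)) :
  entrywise regular A -> entrywise regular B -> closed [set a | A a = B a].
Proof.
move=> RA RB; rewrite (_ : [set a | _] = [set a | forall i j, A a i j = B a i j]).
  apply: (closed_forall (Q := fun i => [set a | forall j, A a i j = B a i j])).
  move=> i; apply: (closed_forall (Q := fun j => [set a | A a i j = B a i j])).
  by move=> j; exact: closed_regular_eq.
by apply/seteqP; split=> a /= => [->//|AB]; apply/matrixP.
Qed.

End RegularFunctions.

Section PolynomialCurves.
Variables (F : closedFieldType) (I : finType).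
Implicit Types (c : F -> affine F I) (q r : {poly F}).

Definition polynomial_fun (f : F -> F) : Prop :=
  exists p : {poly F}, forall s, p.[s] = f s.

Lemma polynomial_algebra : function_algebra polynomial_fun.
Proof.
split=> [c|f g [p pf] [q qg]|f g [p pf] [q qg]].
- by exists c%:P => s; rewrite hornerC.
- by exists (p + q) => s; rewrite hornerD pf qg.
- by exists (p * q) => s; rewrite hornerM pf qg.
Qed.

Lemma polynomial_line u v : polynomial_fun (fun s => u + s * v).
Proof. by exists (u%:P + 'X * v%:P) => s; rewrite !hornerE. Qed.

Definition polynomial_curve c : Prop := forall i, polynomial_fun (fun s => c s i).

Lemma poly_eval_curve c (p : {mpoly F[#|I|]}) :
  polynomial_curve c -> polynomial_fun (fun s => poly_eval p (c s)).
Proof.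
move=> cpoly; have alg := polynomial_algebra.
under eq_fun do rewrite /poly_eval mevalE.
apply: algebra_sum => // m; apply: algebraM => //; first exact: algebra_cst.
apply: algebra_prod => // i; elim: (m i) => [|k IHk].
  under eq_fun do rewrite expr0.
  exact: algebra_cst.
by under eq_fun do rewrite exprS; exact: algebraM.
Qed.

Lemma nonroot_poly q : q != 0 -> exists s, q.[s] != 0.
Proof. by move/closed_nonrootP => [s qs]; exists s. Qed.

(** A curve lies generically in a set if it does so away from the roots of some
    nonzero polynomial, that is, for all but finitely many parameters. *)
Definition generically_in c (S : set (affine F I)) : Prop :=
  exists2 q, q != 0 & forall s, q.[s] != 0 -> S (c s).

(** A polynomial that vanishes on the set restricts to a one-variable polynomial
    along the curve; multiplied by [q] it vanishes everywhere, so it is zero. *)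
Lemma closed_curve (Z : set (affine F I)) c s : closed Z ->
  polynomial_curve c -> generically_in c Z -> Z (c s).
Proof.
move=> /zariski_closedP[S ->] cpoly [q q0 qZ] p Sp.
have [r rE] := poly_eval_curve p cpoly; rewrite -rE.
suff -> : r = 0 by rewrite horner0.
apply: contraTeq isT => r0; have /nonroot_poly[t] := mulf_neq0 q0 r0.
by rewrite hornerM mulf_eq0 negb_or rE => /andP[/qZ/(_ p Sp) ->]; rewrite eqxx.
Qed.

(** If polynomials [p] and [p'], vanishing on two closed sets that cover [S], are
    nonzero at [a] and [b] respectively, then their restrictions to the curve
    joining [a] and [b] are nonzero, and so is their product; a parameter where
    it does not vanish yields a point of [S] outside of both closed sets. *)
Lemma irreducible_curves (S : set (affine F I)) : S !=set0 ->
  (forall a b, S a -> S b -> exists c,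
     [/\ polynomial_curve c, c 0 = a, c 1 = b & generically_in c S]) ->
  irreducible S.
Proof.
move=> S0 Scurve; split=> // A B /zariski_closedP[SA ->] /zariski_closedP[SB ->].
move=> SAB; apply: contrapT => /not_orP[/existsNP[a /not_implyP[Sa]]].
move=> /existsNP[p /not_implyP[Ap /eqP pa]] /existsNP[b /not_implyP[Sb]].
move=> /existsNP[p' /not_implyP[Bp' /eqP p'b]].
have [c [cpoly c0 c1 [q q0 qS]]] := Scurve a b Sa Sb.
have [r rE] := poly_eval_curve p cpoly.
have [r' r'E] := poly_eval_curve p' cpoly.
have r0 : r != 0 by apply: contra_neq pa; rewrite -c0 -rE => ->; rewrite horner0.
have r'0 : r' != 0.
  by apply: contra_neq p'b; rewrite -c1 -r'E => ->; rewrite horner0.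
have /nonroot_poly[s] := mulf_neq0 q0 (mulf_neq0 r0 r'0).
rewrite !hornerM !mulf_eq0 !negb_or rE r'E => /and3P[/qS/SAB[/(_ _ Ap)|/(_ _ Bp')] ->].
all: by rewrite eqxx.
Qed.

End PolynomialCurves.

(** * Laws and their orbits *)

Section LawAlgebra.
Variables (F : fieldType) (n : nat).
Local Notation V := 'rV[F]_n.
Implicit Types (a b : law_space F n) (x y z : V) (g h : 'M[F]_n).

Lemma law_of_mulmxl a x y :
  law_of a x y = x *m \matrix_(i, k) \sum_j a (i, j, k) * y 0 j.
Proof.
apply/rowP => k; rewrite !mxE; apply: eq_bigr => i _.
by rewrite mxE mulr_sumr; apply: eq_bigr => j _; rewrite mulrCA mulrA.
Qed.

Lemma law_of_mulmxr a x y :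
  law_of a x y = y *m \matrix_(j, k) \sum_i a (i, j, k) * x 0 i.
Proof.
apply/rowP => k; rewrite !mxE exchange_big; apply: eq_bigr => j _.
by rewrite mxE mulr_sumr; apply: eq_bigr => i _; rewrite mulrC.
Qed.

Lemma law_of_is_bilinear a : bilinear_for *:%R *:%R (law_of a).
Proof.
split=> [y|x] c u v /=.
  by rewrite !law_of_mulmxl mulmxDl -scalemxAl.
by rewrite !law_of_mulmxr mulmxDl -scalemxAl.
Qed.

HB.instance Definition _ a :=
  bilinear_isBilinear.Build F V V V *:%R *:%R (law_of a) (law_of_is_bilinear a).

(** The adjugate replaces the inverse matrix, so that the structure constants
    are polynomial in [c], [g] and [a]; the scalar [c] absorbs the determinant. *)
Definition transport_law (c : F) g a : law_space F n :=
  constants_of (fun x y => c *: (law_of a (x *m g) (y *m g) *m \adj g)).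

Fact transport_is_bilinear c g a : bilinear_for *:%R *:%R
  (fun x y => c *: (law_of a (x *m g) (y *m g) *m \adj g)).
Proof.
split=> [y|x] d u v /=.
  by rewrite mulmxDl -scalemxAl linearPl mulmxDl -scalemxAl scalerDr !scalerA mulrC.
by rewrite mulmxDl -scalemxAl linearPr mulmxDl -scalemxAl scalerDr !scalerA mulrC.
Qed.

Lemma transport_lawE c g a x y :
  law_of (transport_law c g a) x y =
  c *: (law_of a (x *m g) (y *m g) *m \adj g).
Proof.
pose B := bilinear_isBilinear.Build F V V V *:%R *:%R _ (transport_is_bilinear c g a).
pose f : {bilinear V -> V -> V} := HB.pack
  (fun x y => c *: (law_of a (x *m g) (y *m g) *m \adj g)) B.
exact: (constants_ofK f).
Qed.

Lemma law_of_inj a b : (forall x y, law_of a x y = law_of b x y) -> a = b.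
Proof.
move=> ab; rewrite -[a]law_ofK -[b]law_ofK; congr constants_of.
by apply/funext => x; apply/funext => y.
Qed.

(** Orbits are stable under nonzero scaling: the homothety of ratio [c] turns a
    law into its multiple by [c]. *)
Lemma law_orbitP a b : law_orbit a b <->
  exists c g, [/\ c != 0, \det g != 0 & b = transport_law c g a].
Proof.
split=> [[g gU bE]|[c [g [c0 g0 ->]]]].
  exists (\det g)^-1, g; have g0 : \det g != 0 by rewrite -unitfE -unitmxE.
  split=> //; first by rewrite invr_eq0.
  by apply: law_of_inj => x y; rewrite bE transport_lawE /invmx gU scalemxAr.
have gU : g \in unitmx by rewrite unitmxE unitfE.
have d0 : c * \det g != 0 by rewrite mulf_neq0.
exists ((c * \det g) *: g); first by rewrite unitmxZ // unitfE.
move=> x y; rewrite transport_lawE invmxZ ?unitmxZ ?unitfE // -!scalemxAr.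
rewrite linearZl_LR linearZr_LR -!scalemxAl !scalerA mulVf // mul1r /=.
by rewrite /invmx gU -scalemxAr scalerA mulfK.
Qed.

Lemma law_orbit_refl a : law_orbit a a.
Proof.
exists 1%:M; first exact: unitmx1.
by move=> x y; rewrite invmx1 !mulmx1.
Qed.

End LawAlgebra.

(** * The lower central series *)

Section LowerCentral.
Variables (F : fieldType) (n : nat).
Local Notation V := 'rV[F]_n.
Implicit Types (mu : V -> V -> V) (S : set V) (U W : {vspace V}).

Lemma sub_linear_span S : S `<=` linear_span S.
Proof. by move=> s Ss U; apply. Qed.

(** A subspace of least dimension among those containing [S] is contained in
    each of them, for otherwise its intersection with one of them would be
    smaller. *)
Lemma linear_span_vspace S : exists U, [set` U] = linear_span S.
Proof.
have exd : exists d, `[< exists U, (forall s, S s -> s \in U) /\ \dim U = d >].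
  by exists (\dim {:V}%VS); apply/asboolP; exists fullv; split=> // s _; exact: memvf.
have [d /asboolP[U [SU dU]] dmin] := ex_minnP exd.
exists U; apply/seteqP; split=> v /=; last by apply.
move=> vU W SW; move: vU.
suff /eqP <- : (W :&: U)%VS == U by rewrite memv_cap => /andP[].
rewrite eqEdim capvSr dU dmin //; apply/asboolP; exists (W :&: U)%VS.
by split=> // s Ss; rewrite memv_cap SW ?SU.
Qed.

Lemma linear_span_kernel S (f : {linear V -> V}) :
  (forall s, S s -> f s = 0) -> forall v, linear_span S v -> f v = 0.
Proof.
move=> fS v Sv; have := Sv (lker (linfun f)).
by rewrite memv_ker lfunE => /(_ _)/eqP; apply => s /fS; rewrite memv_ker lfunE => ->.
Qed.

Lemma linear_span0 S : (forall s, S s -> s = 0) -> linear_span S = [set 0].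
Proof.
move=> S0; apply/seteqP; split=> [v|_ ->] /=; last by move=> U _; exact: mem0v.
exact: (@linear_span_kernel S idfun).
Qed.

Lemma linear_spanS S S' : S `<=` S' -> linear_span S `<=` linear_span S'.
Proof. by move=> SS' v Sv U S'U; apply: Sv => s /SS'; exact: S'U. Qed.

Lemma lower_centralS mu k : lower_central mu k.+1 `<=` lower_central mu k.
Proof.
elim: k => [|k IHk] //=; apply: linear_spanS => _ [x /IHk xC [y _ <-]].
by exists x => //; exists y.
Qed.

Lemma lower_central_mul mu k x y :
  lower_central mu k x -> lower_central mu k.+1 (mu x y).
Proof. by move=> xC; apply: sub_linear_span; exists x => //; exists y. Qed.

Lemma lower_central_vspace mu k : exists U, [set` U] = lower_central mu k.
Proof.
case: k => [|k]; last exact: linear_span_vspace.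
by exists fullv; apply/seteqP; split=> v //= _; exact: memvf.
Qed.

(** Each term of the series determines the next one, so a repetition would make
    the series constant from there on; hence the dimension drops at each step
    until it reaches zero. *)
Lemma nilpotent_law_dim mu : nilpotent_law mu -> lower_central mu n = [set 0].
Proof.
move=> [m Cm0]; have /choice[C CE] := lower_central_vspace mu.
have CS k : (C k.+1 <= C k)%VS.
  apply/subvP => v vC; have := @lower_centralS mu k v; rewrite -!CE; exact.
have C0 k : C k = 0%VS -> lower_central mu k = [set 0].
  by rewrite -CE => ->; apply/seteqP; split=> v /=; rewrite memv0 => /eqP.
have stable k : C k.+1 = C k -> C k = 0%VS.
  move=> Ck; have Cstep j : lower_central mu (k + j) = lower_central mu k.
    elim: j => [|j IHj]; first by rewrite addn0.
    by rewrite addnS /= IHj -[LHS]/(lower_central mu k.+1) -!CE Ck.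
  apply/eqP; rewrite -subv0; apply/subvP => v vC; rewrite memv0; apply/eqP.
  have /(_ m) := Cstep; have : lower_central mu k v by rewrite -CE.
  move=> /[swap] <-; elim: k {Ck Cstep vC} => [|k IHk].
    by rewrite add0n Cm0.
  by rewrite addSn => /lower_centralS.
have dimC k : (\dim (C k) <= n - k)%N.
  elim: k => [|k IHk].
    by rewrite subn0 (leq_trans (dimvS (subvf _))) ?dimvf /dim //= mul1n.
  have [/eqP/stable Ck|neq] := boolP (C k.+1 == C k).
    by have := CS k; rewrite Ck subv0 => /eqP ->; rewrite dimv0.
  have : (\dim (C k.+1) < \dim (C k))%N.
    rewrite ltn_neqAle dimvS // andbT; apply: contra neq.
    by rewrite eqEdim CS /= => /eqP ->.
  by move=> /leq_trans/(_ IHk); rewrite subnS -ltnS; case: (n - k)%N.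
by apply: C0; apply/eqP; have := dimC n; rewrite subnn leqn0 dimv_eq0.
Qed.

End LowerCentral.

(** * Laws given by tables, and lines of laws *)

Section LawsInCoordinates.
Variables (F : fieldType) (n : nat).
Local Notation V := 'rV[F]_n.
Implicit Types (a b : law_space F n) (g h : 'M[F]_n).

Lemma transport_law_unitE g a (x y : V) : g \in unitmx ->
  law_of (transport_law (\det g)^-1 g a) x y =
  law_of a (x *m g) (y *m g) *m invmx g.
Proof. by move=> gU; rewrite transport_lawE /invmx gU -scalemxAr. Qed.

Definition affine_line a b (s : F) : law_space F n :=
  [ffun t => a t + s * (b t - a t)].

Lemma affine_line0 a b : affine_line a b 0 = a.
Proof. by apply/ffunP => t; rewrite ffunE mul0r addr0. Qed.

Lemma law_of_affine_line a b s x y : law_of (affine_line a b s) x y =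
  law_of a x y + s *: (law_of b x y - law_of a x y).
Proof.
apply/rowP => k; rewrite !mxE -!sumrB mulr_sumr -big_split; apply: eq_bigr => i _.
rewrite -!sumrB mulr_sumr -big_split; apply: eq_bigr => j _ /=.
by rewrite ffunE; ring.
Qed.

Lemma law_of_tableE T (x y : V) :
  law_of (law_of_table T) x y = \sum_i \sum_j (x 0 i * y 0 j) *: T i.+1 j.+1.
Proof.
apply/rowP => k; rewrite !mxE summxE; apply: eq_bigr => i _.
rewrite summxE; apply: eq_bigr => j _.
by rewrite !mxE ffunE /=; ring.
Qed.

Lemma basis_vecE (i : 'I_n) : basis_vec F n i.+1 = delta_mx 0 i.
Proof. by apply/rowP => j; rewrite !mxE eqxx. Qed.

Lemma law_of_rows a h (x y : V) : law_of a (x *m h) (y *m h) =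
  \sum_i \sum_j (x 0 i * y 0 j) *: law_of a (row i h) (row j h).
Proof.
rewrite !mulmx_sum_row linear_sumlz; apply: eq_bigr => i _.
rewrite linear_sumr; apply: eq_bigr => j _.
by rewrite linearZl_LR linearZr_LR /= scalerA.
Qed.

Lemma law_orbit_table T a h : h \in unitmx ->
  (forall i j, law_of a (row i h) (row j h) = T i.+1 j.+1 *m h) ->
  law_orbit (law_of_table T) a.
Proof.
move=> hU aT; exists (invmx h); first by rewrite unitmx_inv.
move=> x y; rewrite invmxK law_of_tableE -{1}[x](mulmxKV hU) -{1}[y](mulmxKV hU).
rewrite law_of_rows mulmx_suml; apply: eq_bigr => i _.
by rewrite mulmx_suml; apply: eq_bigr => j _; rewrite aT scalemxAl.
Qed.

Lemma exists_basis_at (v : V) i : v != 0 -> exists2 h, h \in unitmx & row i h = v.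
Proof.
move=> v0; pose f : 'M[F]_n := \matrix_(j < n) v.
have dF : delta_mx 0 i *m f = v by rewrite -rowE rowK.
have [|g gU gE] := @complete_unitmx _ _ _ (delta_mx 0 i : V) f.
  by rewrite dF mxrank_delta rank_rV v0.
by exists g => //; rewrite rowE -gE.
Qed.

End LawsInCoordinates.

(** * Irreducibility of families of orbits *)

Section OrbitFamilies.
Variables (F : closedFieldType) (n : nat).

(** Two points of the union come from parameters [(c, g, b)] and [(c', g', b')],
    with [c] and [\det g] nonzero; the segment between the parameters is mapped
    to a polynomial curve, which stays in the union except where the polynomial
    [c * \det g] vanishes. *)
Lemma irreducible_orbit_family (m : F -> law_space F n) :
  polynomial_curve m -> irreducible (\bigcup_b law_orbit (m b)).
Proof.
move=> mpoly; apply: irreducible_curves.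
  by exists (m 0), 0 => //; exact: law_orbit_refl.
move=> _ _ [b _ /law_orbitP[c [g [c0 g0 ->]]]] [b' _ /law_orbitP[c' [g' [c'0 g'0 ->]]]].
have alg := polynomial_algebra F.
pose ct s := c + s * (c' - c); pose bt s := b + s * (b' - b).
pose gt s := g + s *: (g' - g).
have gt_poly : entrywise (@polynomial_fun F) gt.
  by move=> i j; rewrite /gt; under eq_fun do rewrite !mxE; exact: polynomial_line.
have mt_poly t : polynomial_fun (fun s => m (bt s) t).
  have [p pE] := mpoly t; have [q qE] := polynomial_line b (b' - b).
  by exists (p \Po q) => s; rewrite horner_comp qE pE.
exists (fun s => transport_law (ct s) (gt s) (m (bt s))); split.
- move=> t; rewrite /transport_law /constants_of.
  under eq_fun do rewrite ffunE.
  apply: entrywiseZ => //; first exact: polynomial_line.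
  apply: entrywise_mul => //; last exact: entrywise_adj.
  by apply: entrywise_law => //; apply: entrywise_mul => //; exact: entrywise_cst.
- by rewrite /ct /gt /bt !mul0r scale0r !addr0.
- by rewrite /ct /gt /bt !mul1r scale1r ![_ + (_ - _)]addrC !subrK.
- have [q qE] := algebraM alg (polynomial_line c (c' - c)) (algebra_det alg gt_poly).
  exists q => [|s].
    apply: contra_neq (mulf_neq0 c0 g0) => q0; move: (qE 0).
    by rewrite q0 horner0 /gt mul0r scale0r !addr0 => <-.
  rewrite qE mulf_eq0 negb_or => /andP[cs0 gs0]; exists (bt s) => //.
  by apply/law_orbitP; exists (ct s), (gt s).
Qed.

End OrbitFamilies.

(** * Dimension three *)

Local Notation i0 := (@Ordinal 3 0 isT).
Local Notation i1 := (@Ordinal 3 1 isT).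
Local Notation i2 := (@Ordinal 3 2 isT).

Lemma ord3_ind (Q : 'I_3 -> Prop) : Q i0 -> Q i1 -> Q i2 -> forall i, Q i.
Proof.
by move=> Q0 Q1 Q2 [[|[|[|//]]] im]; [move: Q0|move: Q1|move: Q2];
  congr Q; exact: val_inj.
Qed.

Lemma sum_ord3 (M : nmodType) (f : 'I_3 -> M) : \sum_i f i = f i0 + f i1 + f i2.
Proof.
rewrite !big_ord_recl big_ord0 addr0 addrA.
by do ?congr (_ + _); congr f; exact: val_inj.
Qed.

Section Rows3.
Variable F : fieldType.
Local Notation V := 'rV[F]_3.
Implicit Types (u v w : V).

Definition rows3 u v w : 'M[F]_3 := \matrix_i nth 0 [:: u; v; w] i.

Lemma row_rows3 u v w i : row i (rows3 u v w) = nth 0 [:: u; v; w] i.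
Proof. exact: rowK. Qed.

Lemma mulmx_rows3 (c : V) u v w :
  c *m rows3 u v w = c 0 i0 *: u + c 0 i1 *: v + c 0 i2 *: w.
Proof. by rewrite mulmx_sum_row sum_ord3 !row_rows3. Qed.

Lemma rows3_unitP u v w :
  (forall c : V, c 0 i0 *: u + c 0 i1 *: v + c 0 i2 *: w = 0 -> c = 0) <->
  rows3 u v w \in unitmx.
Proof.
split=> [uvw|hU c].
  by rewrite -row_free_unit; apply: inj_row_free => c; rewrite mulmx_rows3; exact: uvw.
rewrite -mulmx_rows3 => /(congr1 (mulmx^~ (invmx (rows3 u v w)))).
  by rewrite mulmxK // mul0mx.
Qed.

Lemma rows3_coord u v w x : rows3 u v w \in unitmx ->
  exists c : V, x = c 0 i0 *: u + c 0 i1 *: v + c 0 i2 *: w.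
Proof.
by move=> hU; exists (x *m invmx (rows3 u v w)); rewrite -mulmx_rows3 mulmxKV.
Qed.

Lemma basis_vec_mulmx (h : 'M[F]_3) :
  (basis_vec F 3 1 *m h = row i0 h) * (basis_vec F 3 2 *m h = row i1 h) *
  (basis_vec F 3 3 *m h = row i2 h).
Proof.
by rewrite !rowE -!basis_vecE.
Qed.

(** Any complement of the plane spanned by [v] and [w] is a line. *)
Lemma exists_line_supplement v w : v != 0 -> w \notin <[v]>%VS ->
  exists u, forall x, exists c y z, x = c *: u + y *: v + z *: w.
Proof.
move=> v0 wv; pose K := (<[v]> + <[w]>)%VS.
have dK : (1 < \dim K)%N.
  rewrite ltnNge; apply: contra wv => dK1; have /eqP -> : <[v]>%VS == K.
    by rewrite eqEdim addvSl dim_vline v0.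
  by rewrite memvE addvSr.
have dKC : (\dim K^C <= 1)%N.
  by rewrite dimv_compl dimvf /dim /= mul1n leq_subLR addn1.
have KCE : <[vpick K^C]>%VS = (K^C)%VS.
  apply/eqP; rewrite eqEdim -memvE memv_pick dim_vline vpick0.
  by have [->|_] := eqVneq; rewrite ?dimv0.
exists (vpick K^C) => x; have : x \in (K + K^C)%VS by rewrite addv_complf memvf.
move=> /memv_addP[_ /memv_addP[_ /vlineP[y ->] [_ /vlineP[z ->] ->]] [t tKC ->]].
have /vlineP[c ->] : t \in <[vpick K^C]>%VS by rewrite KCE.
by exists c, y, z; rewrite addrC addrA.
Qed.

End Rows3.

Section Tables.
Variable F : fieldType.
Local Notation e := (basis_vec F 3).
Implicit Types x y : 'rV[F]_3.

Lemma law_of_mu1 x y : law_of (mu1 F) x y =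
  y 0 i0 *: (x 0 i0 *: e 2 + x 0 i1 *: e 3).
Proof.
rewrite law_of_tableE !sum_ord3 /= !scaler0 !addr0 scalerDr !scalerA.
by rewrite ![y 0 _ * _]mulrC.
Qed.

Lemma law_of_mu2 b x y : law_of (mu2 b) x y =
  (x 0 i0 * y 0 i0 + x 0 i0 * y 0 i2 + b * (x 0 i2 * y 0 i2)) *: e 2.
Proof.
rewrite law_of_tableE !sum_ord3 /= !scaler0 !addr0 !add0r !scalerDl !scalerA.
by rewrite [b * _]mulrC.
Qed.

End Tables.

(** * Nilpotent Leibniz laws in dimension three *)

Section NilpotentLeibniz3.
Variable F : fieldType.
Local Notation V := 'rV[F]_3.
Local Notation e := (basis_vec F 3).
Implicit Types (a b : law_space F 3) (u v w x y z : V).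

Definition triple_null a := forall x y z w : V,
  law_of a (law_of a (law_of a x y) z) w = 0.

(** For Leibniz laws the second identity follows from the first; stated together
    they say that all products lie in the two-sided annihilator. *)
Definition annihilated a := forall x y z : V,
  law_of a (law_of a x y) z = 0 /\ law_of a x (law_of a y z) = 0.

Lemma lower_central3 a : lower_central (law_of a) 3 = [set 0] <-> triple_null a.
Proof.
split=> [C3 x y z w|a0].
  suff : lower_central (law_of a) 3 (law_of a (law_of a (law_of a x y) z) w).
    by rewrite C3.
  by do 3![apply: lower_central_mul].
pose r z : {linear V -> V} := mulmxr (\matrix_(i, k) \sum_j a (i, j, k) * z 0 j).
have rE x z : law_of a x z = r z x by exact: law_of_mulmxl.
(* Right multiplications are linear, so their kernels absorb linear spans:
   the three nested spans are peeled off one at a time. *)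
apply: linear_span0 => _ [s Ss [w _ <-]]; rewrite rE.
apply: (linear_span_kernel (f := r w)) Ss => _ [t St [z _ <-]]; rewrite rE.
apply: (linear_span_kernel (f := r w \o r z)) St => _ [x _ [y _ <-]].
by rewrite -[LHS]/(r w (r z (law_of a x y))) -!rE a0.
Qed.

Lemma LeibN3E : LeibN F 3 = [set a | leibniz (law_of a) /\ triple_null a].
Proof.
apply/seteqP; split=> a [aL aN]; split=> //.
  by apply/lower_central3; exact: nilpotent_law_dim.
by exists 3; apply/lower_central3.
Qed.

Lemma entrywise_regular_law (x y : law_space F 3 -> V) :
  entrywise (@regular F _) x -> entrywise (@regular F _) y ->
  entrywise (@regular F _) (fun a => law_of a (x a) (y a)).
Proof.
by apply: entrywise_law; [exact: regular_algebra|exact: regular_coord].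
Qed.

Lemma entrywise_regular_cst (x : V) :
  entrywise (@regular F ('I_3 * 'I_3 * 'I_3)%type) (fun=> x).
Proof. by apply: entrywise_cst; exact: regular_algebra. Qed.

Lemma closed_LeibN3 : closed (LeibN F 3).
Proof.
have cst := entrywise_regular_cst; have mul := entrywise_regular_law.
rewrite LeibN3E; apply: closedI.
  do 3![apply: closed_forall => ?]; apply: closed_entrywise_eq.
    by repeat (apply cst || apply mul).
  apply: entrywiseB; first exact: regular_algebra.
    by repeat (apply cst || apply mul).
  by repeat (apply cst || apply mul).
do 4![apply: closed_forall => ?]; apply: closed_entrywise_eq; last by apply cst.
by repeat (apply cst || apply mul).
Qed.

Lemma LeibN3_orbit a b : LeibN F 3 a -> law_orbit a b -> LeibN F 3 b.
Proof.
rewrite LeibN3E => -[aL a0] [g gU bE]; split=> [x y z|x y z w].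
  by rewrite !bE !mulmxKV // aL mulmxBl.
by rewrite !bE !mulmxKV // a0 mul0mx.
Qed.

Lemma annihilated_orbit a b : annihilated a -> law_orbit a b -> annihilated b.
Proof.
move=> a0 [g gU bE] x y z; have [a0l a0r] := a0 (x *m g) (y *m g) (z *m g).
by rewrite !bE !mulmxKV // a0l a0r !mul0mx.
Qed.

Lemma annihilated_LeibN a : annihilated a -> LeibN F 3 a.
Proof.
move=> a0; rewrite LeibN3E; split=> [x y z|x y z w].
  by rewrite (a0 x y z).2 (a0 x y z).1 (a0 x z y).1 subr0.
by rewrite (a0 x y z).1 linear0l.
Qed.

Lemma closed_annihilated : closed [set a | annihilated a].
Proof.
have cst := entrywise_regular_cst; have mul := entrywise_regular_law.
do 3![apply: closed_forall => ?].
by apply: closedI; apply: closed_entrywise_eq; repeat (apply cst || apply mul).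
Qed.

Section Filiform.
Variable a : law_space F 3.
Local Notation "x ** y" := (law_of a x y) (at level 40, left associativity).

(** Multiplying a linear relation on the right by [y] and [z] kills all of its
    terms but the first one; multiplying then by [z] isolates the second. *)
Lemma filiform_rows3 x y z : triple_null a -> x ** y ** z != 0 ->
  rows3 x (x ** y) (x ** y ** z) \in unitmx.
Proof.
move=> a0 xyz0; apply/rows3_unitP => c cE.
have := congr1 (fun t => t ** y ** z) cE.
rewrite !linear0l !linearDl !linearZl_LR /= !a0.
rewrite !scaler0 !addr0 => /eqP; rewrite scaler_eq0 (negPf xyz0) orbF => /eqP c0.
have := congr1 (fun t => t ** z) cE.
rewrite c0 scale0r add0r !linear0l !linearDl !linearZl_LR /= a0.
rewrite scaler0 addr0 => /eqP; rewrite scaler_eq0 (negPf xyz0) orbF => /eqP c1.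
move: cE; rewrite c0 c1 !scale0r !add0r => /eqP; rewrite scaler_eq0 (negPf xyz0).
by rewrite orbF => /eqP c2; apply/rowP; apply: ord3_ind; rewrite mxE.
Qed.

(** Writing [y] and [z] in the basis x, xy, (xy)z shows that (xy)z is a multiple
    of (xx)x: the parts of [y] and [z] that are products contribute nothing, by
    [rCC] and [CC].  So (xx)x is nonzero and x, xx, (xx)x is a basis; the
    vanishing of all products in it other than xx and (xx)x comes from
    p(qq) = 0 and from the absence of nonzero fourfold products. *)
Lemma filiform_orbit x y z : leibniz (law_of a) -> triple_null a ->
  x ** y ** z != 0 -> law_orbit (mu1 F) a.
Proof.
move=> aL a0 xyz0.
have CC p q r s : (p ** q) ** (r ** s) = 0 by rewrite aL !a0 subrr.
have rCC p q r s : p ** (q ** r) ** s = 0 by rewrite aL linearBl /= !a0 subrr.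
have sqr p q : p ** (q ** q) = 0 by rewrite aL subrr.
have xxx0 : x ** x ** x != 0.
  have hU := filiform_rows3 a0 xyz0.
  have [c yE] := rows3_coord y hU; have [d zE] := rows3_coord z hU.
  apply: contra_neq xyz0 => xxx0.
  have -> t : x ** y ** t = c 0 i0 *: (x ** x ** t).
    rewrite {1}yE !linearDr !linearZr_LR !linearDl !linearZl_LR /= !rCC.
    by rewrite !scaler0 !addr0.
  by rewrite {1}zE !linearDr !linearZr_LR /= !CC xxx0 !scaler0 !addr0 scaler0.
have hU := filiform_rows3 a0 xxx0.
apply: (law_orbit_table hU); apply: ord3_ind; apply: ord3_ind;
  rewrite !row_rows3 /= ?mul0mx ?basis_vec_mulmx ?row_rows3 //= ?CC ?sqr ?a0 //.
by rewrite aL sqr CC linear0l subrr.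
Qed.

End Filiform.

(** A second product [w] independent of [v] = pq would annihilate everything, as
    [v] does, so every product would be a multiple of uu, where u spans a
    supplement of the plane of [v] and [w]; then [v] and [w] would be
    proportional. *)
Lemma annihilated_line a : annihilated a -> exists v : V,
  [/\ v != 0, forall x, law_of a x v = 0 /\ law_of a v x = 0 &
      forall x y, exists c, law_of a x y = c *: v].
Proof.
move=> a0; have [[p [q pq0]]|/forallNP m0] :=
  pselect (exists p q, law_of a p q != 0); last first.
  have {}m0 x y : law_of a x y = 0.
    by have /forallNP/(_ y)/negP := m0 x; rewrite negbK => /eqP.
  exists (e 1); split=> [|x|x y]; rewrite ?m0 //.
    by apply/eqP => /rowP/(_ i0); rewrite !mxE => /eqP; rewrite oner_eq0.
  by exists 0; rewrite scale0r.
set v := law_of a p q in pq0.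
have vA x : law_of a x v = 0 /\ law_of a v x = 0.
  by rewrite (a0 x p q).2 (a0 p q x).1.
exists v; split=> // x y; set w := law_of a x y.
have wA t : law_of a t w = 0 /\ law_of a w t = 0.
  by rewrite (a0 t x y).2 (a0 x y t).1.
apply/vlineP; apply/negPn/negP => wv.
have [u uE] := exists_line_supplement pq0 wv.
have all_uu s t : exists c, law_of a s t = c *: law_of a u u.
  have [c [d [d' ->]]] := uE s; have [c' [f [f' ->]]] := uE t; exists (c' * c).
  rewrite !linearDr !linearZr_LR /= (vA _).1 (wA _).1 !linearDl !linearZl_LR /=.
  by rewrite (vA u).2 (wA u).2 !scaler0 !addr0 scalerA.
have [c vE] := all_uu p q; have [d wE] := all_uu x y.
have c0 : c != 0 by apply: contra_neq pq0; rewrite /v vE => ->; rewrite scale0r.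
case/negP: wv; apply/vlineP; exists (d / c).
by rewrite /v /w vE wE scalerA divfK.
Qed.

End NilpotentLeibniz3.

(** * The family of the laws mu_{2,b} *)

Section Mu2Orbits.
Variable F : fieldType.
Local Notation V := 'rV[F]_3.
Implicit Types (a : law_space F 3) (f v k : V).

(** The form with matrix ((al, be), (ga, de)) on the plane of [f] and [k] is
    normalised by replacing [k] with a vector [k'] such that k'f = 0, scaled so
    that fk' = ff. *)
Lemma mu2_orbit a f v k al be ga de : rows3 f v k \in unitmx ->
  (forall x, law_of a x v = 0 /\ law_of a v x = 0) ->
  law_of a f f = al *: v -> law_of a f k = be *: v ->
  law_of a k f = ga *: v -> law_of a k k = de *: v ->
  al != 0 -> be != ga -> exists b, law_orbit (mu2 b) a.
Proof.
move=> hU va ff fk kf kk al0; rewrite -subr_eq0 => bg0.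
(* Subtracting the multiple of [f] makes k'f = 0, and then the factor [d] makes
   fk' = ff; the remaining coefficient of k'k' over ff is the parameter. *)
pose d := al / (be - ga); pose k' := d *: (k - (ga / al) *: f).
have d0 : d != 0 by rewrite mulf_neq0 ?invr_eq0.
have hU' : rows3 f (al *: v) k' \in unitmx.
  apply/rows3_unitP => c; rewrite /k' scalerBr !scalerA => cE.
  pose c' : V := \row_i
    nth 0 [:: c 0 i0 - c 0 i2 * d * (ga / al); c 0 i1 * al; c 0 i2 * d] i.
  have /rowP c'0 : c' = 0.
    apply: ((rows3_unitP _ _ _).2 hU); rewrite !mxE /= -[RHS]cE.
    by apply/rowP => i; rewrite !mxE; ring.
  have := c'0 i1; rewrite !mxE => /eqP; rewrite mulf_eq0 (negPf al0) orbF => /eqP c1.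
  have := c'0 i2; rewrite !mxE => /eqP; rewrite mulf_eq0 (negPf d0) orbF => /eqP c2.
  have := c'0 i0; rewrite !mxE /= c2 !mul0r subr0 => c0.
  by apply/rowP; apply: ord3_ind; rewrite mxE.
exists ((d ^+ 2 * (de - ga * be / al)) / al); apply: (law_orbit_table hU').
have fk' : law_of a f k' = al *: v.
  rewrite !(linearZr_LR, linearBr) /= ff fk !scalerA -scalerBl scalerA.
  by congr (_ *: _); rewrite /d; field; rewrite ?al0 ?bg0.
have k'f : law_of a k' f = 0.
  rewrite !(linearZl_LR, linearBl) /= ff kf !scalerA -scalerBl scalerA.
  by rewrite divfK ?subrr ?mulr0 ?scale0r.
have k'k' : law_of a k' k' = (d ^+ 2 * (de - ga * be / al)) *: v.
  rewrite {2}/k' !(linearZr_LR, linearBr) /= k'f scaler0 subr0.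
  rewrite /k' !(linearZl_LR, linearBl) /= fk kk !scalerA -scalerBl !scalerA.
  congr (_ *: _).
  by field.
have va' c x : law_of a x (c *: v) = 0 /\ law_of a (c *: v) x = 0.
  by rewrite linearZr_LR linearZl_LR /= (va x).1 (va x).2 scaler0.
apply: ord3_ind; apply: ord3_ind;
  rewrite !row_rows3 /= -?scalemxAl ?mul0mx ?basis_vec_mulmx ?row_rows3 //=
    ?(va' _ _).1 ?(va' _ _).2 // k'k' scalerA divfK //.
Qed.

End Mu2Orbits.

Section ClassificationClosure.
Variable F : closedFieldType.
Local Notation V := 'rV[F]_3.
Implicit Types (a : law_space F 3) (x y : V).

Lemma polynomial_mu2 : polynomial_curve (@mu2 F).
Proof.
case=> [[i j] k]; pose c : F := (i == i2)%:R * (j == i2)%:R * (k == i1)%:R.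
have bE b : mu2 b (i, j, k) = mu2 (0 : F) (i, j, k) + b * c.
  rewrite {}/c; move: i j k; do 3![apply: ord3_ind];
    by rewrite !ffunE /= !mxE /= ?(mulr0, mulr1, mul0r, addr0, add0r).
under eq_fun do rewrite bE.
exact: polynomial_line.
Qed.

Lemma annihilated_mu2 (b : F) : annihilated (mu2 b).
Proof.
by move=> x y z; rewrite !law_of_mu2 !mxE /= !mulr0 !mul0r !addr0 !mulr0 !addr0 scale0r.
Qed.

Lemma LeibN_mu1 : LeibN F 3 (mu1 F).
Proof.
rewrite LeibN3E; split=> [x y z|x y z w].
  by apply/rowP => k; rewrite !law_of_mu1 !mxE /=; ring.
by rewrite !law_of_mu1; apply/rowP => k; rewrite !mxE /=; ring.
Qed.

(** In a basis f, v, k with all products on the line of [v], the law is a bilinear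
    form on the plane of f and k.  On the line from this form to that of mu_{2,0},
    the two polynomials required to be nonzero by [mu2_orbit] take the value 1
    at the end, so that they have finitely many roots. *)
Lemma annihilated_closure_mu2 a : annihilated a ->
  closure (\bigcup_(b : F) law_orbit (mu2 b)) a.
Proof.
move=> /annihilated_line[v [v0 vA vE]].
have [h hU hv] := exists_basis_at i1 v0.
pose f := row i0 h; pose k := row i2 h.
have hE : rows3 f v k = h.
  by apply/row_matrixP; apply: ord3_ind; rewrite row_rows3.
have fkU : rows3 f v k \in unitmx by rewrite hE.
pose g := invmx h; have gU : g \in unitmx by rewrite unitmx_inv.
pose a' := transport_law (\det g)^-1 g (mu2 (0 : F)).
have a'E x y : law_of a' x y =
    ((x *m g) 0 i0 * (y *m g) 0 i0 + (x *m g) 0 i0 * (y *m g) 0 i2) *: v.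
  rewrite transport_law_unitE // invmxK law_of_mu2 mul0r addr0 -scalemxAl.
  by rewrite basis_vec_mulmx hv.
have rowg i j : (row i h *m g) 0 j = (j == i)%:R.
  by rewrite -row_mul mulmxV // row1 mxE eqxx.
have a'v x : law_of a' x v = 0 /\ law_of a' v x = 0.
  by rewrite !a'E -hv !rowg !mul0r !mulr0 addr0 scale0r.
have [al ff] := vE f f; have [be fk] := vE f k.
have [ga kf] := vE k f; have [de kk] := vE k k.
have := @closed_curve _ _ _ (affine_line a a') 0
  (@closed_closure _ (\bigcup_(b : F) law_orbit (mu2 b))).
rewrite affine_line0; apply => [t|].
  by under eq_fun do rewrite ffunE; exact: polynomial_line.
pose line c d : {poly F} := c%:P + 'X * (d - c)%:P.
have lineE c d s : (line c d).[s] = c + s * (d - c) by rewrite !hornerE.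
exists (line al 1 * line (be - ga) 1) => [|s].
  apply/eqP => /(congr1 (horner^~ 1)); rewrite hornerM !lineE horner0 !mul1r.
  by rewrite [al + _]addrC [be - ga + _]addrC !subrK mulr1 => /eqP; rewrite oner_eq0.
rewrite hornerM mulf_eq0 negb_or !lineE => /andP[al0 bg0]; apply: subset_closure.
have [x|||||||b bO] := mu2_orbit (a := affine_line a a' s) (al := al + s * (1 - al))
    (be := be + s * (1 - be)) (ga := ga - s * ga) (de := de - s * de) fkU;
  last by exists b.
- rewrite !law_of_affine_line (vA x).1 (vA x).2 (a'v x).1 (a'v x).2.
  by rewrite subrr scaler0 addr0.
- rewrite law_of_affine_line ff a'E !rowg /= mulr1 mulr0 addr0.
  by rewrite -scalerBl scalerA -scalerDl.
- rewrite law_of_affine_line fk a'E !rowg /= mulr1 mulr0 add0r.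
  by rewrite -scalerBl scalerA -scalerDl.
- rewrite law_of_affine_line kf a'E !rowg /= !mul0r addr0 scale0r sub0r.
  by rewrite -scaleNr scalerA -scalerDl mulrN.
- rewrite law_of_affine_line kk a'E !rowg /= !mul0r addr0 scale0r sub0r.
  by rewrite -scaleNr scalerA -scalerDl mulrN.
- exact: al0.
- by rewrite -subr_eq0; apply: contra_neq bg0 => <-; ring.
Qed.

End ClassificationClosure.

(** * The two components *)

Section Components.
Variable F : closedFieldType.
Local Notation V := 'rV[F]_3.
Let X1 : set (law_space F 3) := closure (law_orbit (mu1 F)).
Let X2 : set (law_space F 3) := closure (\bigcup_(b : F) law_orbit (mu2 b)).

Lemma closure_mu2E : X2 = [set a | annihilated a].
Proof.
apply/seteqP; split=> [|a]; last exact: annihilated_closure_mu2.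
rewrite [X in _ `<=` X]((closure_id _).1 (@closed_annihilated F)).
apply: closureS => a [b _]; exact: annihilated_orbit (annihilated_mu2 b).
Qed.

Lemma LeibN3_setU : LeibN F 3 = X1 `|` X2.
Proof.
apply/seteqP; split=> [a|a].
  rewrite LeibN3E => -[aL a0].
  have [[x [y [z xyz]]]|aC] :=
    pselect (exists x y z : V, law_of a (law_of a x y) z != 0).
    by left; apply: subset_closure; exact: filiform_orbit xyz.
  right; rewrite closure_mu2E => x y z /=.
  have a3 s t u : law_of a (law_of a s t) u = 0.
    by apply/eqP/negPn/negP => stu; apply: aC; exists s, t, u.
  by rewrite aL !a3 subrr.
move=> [|]; last by rewrite closure_mu2E; exact: annihilated_LeibN.
rewrite ((closure_id _).1 (@closed_LeibN3 F)); apply: closureS => b.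
exact: LeibN3_orbit (LeibN_mu1 F).
Qed.

(** The 2x2 minors that vanish when xy = phi(y) psi(x) for some linear form phi
    and linear map psi, that is, when right multiplications span at most a
    line. *)
Definition right_rank1 (a : law_space F 3) := forall (x x' y y' : V) k k',
  law_of a x y 0 k * law_of a x' y' 0 k' = law_of a x y' 0 k * law_of a x' y 0 k'.

Lemma closed_right_rank1 : closed [set a | right_rank1 a].
Proof.
have alg := @regular_algebra F ('I_3 * 'I_3 * 'I_3)%type.
have mul := @entrywise_regular_law F; have cst := @entrywise_regular_cst F.
do 6![apply: closed_forall => ?]; apply: closed_regular_eq.
  by apply: algebraM => //; apply: mul; apply cst.
by apply: algebraM => //; apply: mul; apply cst.
Qed.

Lemma closure_mu1_rank1 : X1 `<=` [set a | right_rank1 a].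
Proof.
rewrite ((closure_id _).1 closed_right_rank1); apply: closureS => b [g gU bE].
move=> x x' y y' k k'; rewrite !bE !law_of_mu1 -!scalemxAl.
by rewrite ![(_ *: _ : 'rV_3) 0 _]mxE; ring.
Qed.

Lemma mu1_notin_closure_mu2 : ~ X1 `<=` X2.
Proof.
rewrite closure_mu2E => /(_ (mu1 F) (subset_closure (@law_orbit_refl _ _ _))).
move=> /(_ (delta_mx 0 i0) (delta_mx 0 i0) (delta_mx 0 i0))[/rowP/(_ i2) /eqP + _].
by rewrite !law_of_mu1 !mxE /= !(mulr0, mulr1, addr0, add0r) oner_eq0.
Qed.

Lemma mu2_notin_closure_mu1 : ~ X2 `<=` X1.
Proof.
move=> /subset_trans/(_ closure_mu1_rank1)/(_ (mu2 (1 : F))) /=.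
have mu2X2 : X2 (mu2 1) by apply: subset_closure; exists 1 => //; exact: law_orbit_refl.
move=> /(_ mu2X2 (delta_mx 0 i0) (delta_mx 0 i2)).
move=> /(_ (delta_mx 0 i0) (delta_mx 0 i2) i1 i1) /eqP.
by rewrite !law_of_mu2 !mxE /= !(mulr0, mulr1, addr0, add0r) oner_eq0.
Qed.

Theorem LeibN3_components :
  [/\ LeibN F 3 = X1 `|` X2, X1 <> X2 &
      forall Z, irreducible_component (LeibN F 3) Z <-> Z = X1 \/ Z = X2].
Proof.
split; first exact: LeibN3_setU.
  by move=> X12; apply: mu1_notin_closure_mu2; rewrite X12.
rewrite LeibN3_setU; apply: irreducible_component_setU.
- exact: closed_closure.
- exact: closed_closure.
- apply: irreducible_closure.
  have <- : \bigcup_(b : F) law_orbit (mu1 F) = law_orbit (mu1 F).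
    by apply: bigcup_const; exists 0.
  apply: irreducible_orbit_family => t.
  by apply: algebra_cst; exact: polynomial_algebra.
- by apply: irreducible_closure; apply: irreducible_orbit_family; exact: polynomial_mu2.
- exact: mu1_notin_closure_mu2.
- exact: mu2_notin_closure_mu1.
Qed.

End Components.

Theorem theorem2 (R : realType) :
  let X1 : set (law_space R[i] 3) := closure (law_orbit (mu1 R[i])) in
  let X2 : set (law_space R[i] 3) :=
    closure (\bigcup_(b : R[i]) law_orbit (mu2 b)) in
  [/\ LeibN R[i] 3 = X1 `|` X2,
      X1 <> X2 &
      forall Z : set (law_space R[i] 3),
        irreducible_component (LeibN R[i] 3) Z <-> Z = X1 \/ Z = X2].
Proof. exact: LeibN3_components. Qed.
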